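(* Let $\mathbb{K}$ be the real algebra of octonions and let $\varPhi_{\widetilde M}:\mathbb{K}^4\times\mathbb{K}^4\to\mathbb{K}^7$ be the $\mathbb{R}$-bilinear map sending $(\overrightarrow{a},\overrightarrow{b})=((a_0,a_1,a_2,a_3),(b_0,b_1,b_2,b_3))$ to $(\hat c_0,\hat c_1,\dots,\hat c_6)$, where $$\begin{aligned} \hat c_0&=a_0b_0-b_0a_0,\\ \hat c_1&=\overline{b_0}a_1+a_0\overline{b_1},\\ \hat c_2&=\overline{b_0}a_2+a_1b_1+a_0\overline{b_2},\\ \hat c_3&=b_0a_3+a_2\overline{b_1}-\overline{b_2}a_1+\overline{a_0}b_3,\\ \hat c_4&=a_3b_1+a_2b_2-b_3\overline{a_1}-3b_0a_0,\\ \hat c_5&=a_3b_2+a_2b_3,\\ \hat c_6&=a_3b_3. \end{aligned}$$ Then $\varPhi_{\widetilde M}$ is nonsingular. Moreover, since the octonion commutator $\hat c_0$ always has zero real part, $\varPhi_{\widetilde M}$ takes values in $\mathrm{Im}(\mathbb{K})\oplus\mathbb{K}^6\cong\mathbb{R}^{55}$, so that it is a nonsingular bilinear map $\mathbb{R}^{32}\times\mathbb{R}^{32}\to\mathbb{R}^{55}$.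
   Context: $\mathbb{K}$ denotes the octonions, the classical 8-dimensional real normed division algebra (non-associative), with conjugation $x\mapsto\overline{x}$; $\mathrm{Im}(\mathbb{K})$ is the 7-dimensional real subspace of octonions with zero real part. Bilinear always means $\mathbb{R}$-bilinear, and $\mathbb{K}^n$ is identified with $\mathbb{R}^{8n}$. A bilinear map $\varPhi:V\times W\to U$ of real vector spaces is nonsingular if $\varPhi(\overrightarrow{a},\overrightarrow{b})=\overrightarrow{0}$ implies $\overrightarrow{a}=\overrightarrow{0}$ or $\overrightarrow{b}=\overrightarrow{0}$. The map arises as follows (rows and columns indexed by $0,\dots,3$): put $$M=\begin{bmatrix} a_0b_0 & a_0\overline{b_1} & a_0\overline{b_2} & \overline{a_0}b_3\\ \overline{b_0}a_1 & a_1b_1 & -\overline{b_2}a_1 & -b_3\overline{a_1}\\ \overline{b_0}a_2 & a_2\overline{b_1} & a_2b_2 & a_2b_3\\ b_0a_3 & a_3b_1 & a_3b_2 & a_3b_3\end{bmatrix},\qquad N=\begin{bmatrix} b_0a_0&0&0&0\\0&0&0&b_0a_0\\0&0&b_0a_0&0\\0&b_0a_0&0&0\end{bmatrix},\qquad \widetilde M=M-N.$$ Then $\hat c_k$ is the sum of the entries of $\widetilde M$ in positions $(i,j)$ with $i+j=k$, for $0\le k\le 6$. *)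

(* Defs.v *)
From HB Require Import structures.
From mathcomp Require Import all_boot all_order all_algebra.
From mathcomp Require Import reals.

Set Implicit Arguments.
Unset Strict Implicit.
Unset Printing Implicit Defensive.

Import Order.TTheory GRing.Theory Num.Theory.
Local Open Scope ring_scope.

(* An octonion is the row vector of its 8 real coordinates in the basis produced
   by three Cayley-Dickson doublings of R, so that its coordinate 0 is its real
   part.  The product on 'rV[R]_8 is [omul]; it is not a ring structure since
   it is not associative. *)
Notation oct R := 'rV[R]_8.

(* One doubling step, with the convention
   (p, q) (r, s) = (p r - s^* q, s p + q r^* ) and (p, q)^* = (p^*, - q). *)
Definition cd_conj (R : realType) (n : nat) (conj : 'rV[R]_n -> 'rV[R]_n)
    (x : 'rV[R]_(n + n)) : 'rV[R]_(n + n) :=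
  row_mx (conj (lsubmx x)) (- rsubmx x).

Definition cd_mul (R : realType) (n : nat) (conj : 'rV[R]_n -> 'rV[R]_n)
    (mul : 'rV[R]_n -> 'rV[R]_n -> 'rV[R]_n)
    (x y : 'rV[R]_(n + n)) : 'rV[R]_(n + n) :=
  row_mx (mul (lsubmx x) (lsubmx y) - mul (conj (rsubmx y)) (rsubmx x))
         (mul (rsubmx y) (lsubmx x) + mul (rsubmx x) (conj (lsubmx y))).

Definition rconj (R : realType) : 'rV[R]_1 -> 'rV[R]_1 := id.
Definition rmul (R : realType) : 'rV[R]_1 -> 'rV[R]_1 -> 'rV[R]_1 :=
  @mulmx R 1 1 1.

Definition cconj (R : realType) : 'rV[R]_2 -> 'rV[R]_2 := cd_conj (@rconj R).
Definition cmul (R : realType) : 'rV[R]_2 -> 'rV[R]_2 -> 'rV[R]_2 :=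
  cd_mul (@rconj R) (@rmul R).

Definition qconj (R : realType) : 'rV[R]_4 -> 'rV[R]_4 := cd_conj (@cconj R).
Definition qmul (R : realType) : 'rV[R]_4 -> 'rV[R]_4 -> 'rV[R]_4 :=
  cd_mul (@cconj R) (@cmul R).

Definition oconj (R : realType) : oct R -> oct R := cd_conj (@qconj R).
Definition omul (R : realType) : oct R -> oct R -> oct R :=
  cd_mul (@qconj R) (@qmul R).

Definition ore (R : realType) (x : oct R) : R := x 0 0.

Local Notation "x ** y" := (omul x y) (at level 40, left associativity).

Definition nonsingular (V W U : zmodType) (f : V -> W -> U) : Prop :=
  forall (a : V) (b : W), f a b = 0 -> a = 0 \/ b = 0.

(* K^n is 'M[R]_(n, 8): row i is the i-th octonion. *)
Definition PhiM (R : realType) (a b : 'M[R]_(4, 8)) : 'M[R]_(7, 8) :=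
  let a0 := row 0 a in let a1 := row 1 a in
  let a2 := row 2 a in let a3 := row 3 a in
  let b0 := row 0 b in let b1 := row 1 b in
  let b2 := row 2 b in let b3 := row 3 b in
  \matrix_(k < 7)
    nth 0 [:: a0 ** b0 - b0 ** a0;
              oconj b0 ** a1 + a0 ** oconj b1;
              oconj b0 ** a2 + a1 ** b1 + a0 ** oconj b2;
              b0 ** a3 + a2 ** oconj b1 - oconj b2 ** a1 + oconj a0 ** b3;
              a3 ** b1 + a2 ** b2 - b3 ** oconj a1 - (b0 ** a0) *+ 3;
              a3 ** b2 + a2 ** b3;
              a3 ** b3] k.

Definition Mtilde (R : realType) (a b : 'M[R]_(4, 8)) (i j : 'I_4) : oct R :=
  let a0 := row 0 a in let a1 := row 1 a in
  let a2 := row 2 a in let a3 := row 3 a in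
  let b0 := row 0 b in let b1 := row 1 b in
  let b2 := row 2 b in let b3 := row 3 b in
  let M : seq (seq (oct R)) :=
    [:: [:: a0 ** b0;       a0 ** oconj b1; a0 ** oconj b2;    oconj a0 ** b3];
        [:: oconj b0 ** a1; a1 ** b1;       - (oconj b2 ** a1); - (b3 ** oconj a1)];
        [:: oconj b0 ** a2; a2 ** oconj b1; a2 ** b2;          a2 ** b3];
        [:: b0 ** a3;       a3 ** b1;       a3 ** b2;          a3 ** b3]] in
  let N : seq (seq (oct R)) :=
    [:: [:: b0 ** a0; 0;        0;        0];
        [:: 0;        0;        0;        b0 ** a0];
        [:: 0;        0;        b0 ** a0; 0];
        [:: 0;        b0 ** a0; 0;        0]] in
  nth 0 (nth [::] M i) j - nth 0 (nth [::] N i) j.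

Lemma PhiM_antidiagonal (R : realType) (a b : 'M[R]_(4, 8)) (k : 'I_7) :
  row k (PhiM a b) =
  \sum_(i < 4) \sum_(j < 4 | (i + j == k :> nat)%N) Mtilde a b i j.
Proof.
rewrite rowK /Mtilde /=.
do 16![match goal with |- context [?x ** ?y] => move: (x ** y) => ? end].
case: k => -[|[|[|[|[|[|[|//]]]]]]] ? /=;
  do 5!rewrite ?big_mkcond ?big_ord_recl ?big_ord0 /=;
  rewrite ?subr0 ?addr0 ?add0r.
- by [].
- by rewrite addrC.
- by rewrite !addrA [RHS](ACl (3*2*1))%AC.
- by rewrite !addrA [RHS](ACl (4*3*2*1))%AC.
- by rewrite !mulrS mulr0n addr0 !opprD !addrA [RHS](ACl (5*3*1*2*4*6))%AC.
- by rewrite addrC.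
- by [].
Qed.

Definition ImK_K6 (R : realType) (c : 'M[R]_(7, 8)) : Prop :=
  ore (row 0 c) = 0.

(* The linear coordinates of Im(K) (+) K^6 : the 7 imaginary coordinates of row 0
   followed by the 48 coordinates of the other rows. *)
Definition coords55 (R : realType) (c : 'M[R]_(7, 8)) : 'rV[R]_55 :=
  row_mx (rsubmx (row 0 c : 'rV[R]_(1 + 7)))
         (mxvec (dsubmx (c : 'M[R]_(1 + 6, 8)))).

(* PhiM read through K^4 = R^32 and Im(K) (+) K^6 = R^55. *)
Definition PhiM_R (R : realType) (x y : 'rV[R]_32) : 'rV[R]_55 :=
  coords55 (PhiM (vec_mx (x : 'rV[R]_(4 * 8))) (vec_mx (y : 'rV[R]_(4 * 8)))).

(* Main.v *)
Require Import Defs.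
From HB Require Import structures.
From mathcomp Require Import all_boot all_order all_algebra.
From mathcomp Require Import reals.
From mathcomp Require Import ring lra.

Set Implicit Arguments.
Unset Strict Implicit.
Unset Printing Implicit Defensive.

Import Order.TTheory GRing.Theory Num.Theory.
Local Open Scope ring_scope.

(** The seven equations $\hat c_k = 0$ are solved by eliminating octonions one
    after the other, as over an associative division ring.  What makes this
    legitimate without associativity is the following.

    - The octonions satisfy x^* (x y) = |x|^2 y, hence also
      (y x) x^* = |x|^2 y by conjugation.  So left and right factors can be
      cancelled ([sa_mulKl], [smulKr] and variants), and there are no zero
      divisors.
    - Commuting octonions x, y lie in a common plane R 1 + R z, on which left
      multiplications compose: x (y w) = (x y) w for every w ([commute_mulA]).

    The equation $\hat c_0 = 0$ says that a0 and b0 commute, so a0, b0, their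
    conjugates and the products of these may be regrouped freely when they
    stand on the left.  By $\hat c_6 = a_3 b_3 = 0$ there are three cases:
    b3 <> 0 ([eq0_of_b3_neq0]), a3 <> 0 ([eq0_of_a3_neq0]) and a3 = b3 = 0
    ([a2_or_b2_eq0]).  In each of them the equations $\hat c_k = 0$ with
    1 <= k <= 4, called c1, ..., c4 below, allow to eliminate unknowns until a
    single product w is left, for which they say k w = - l w with k > 0 and
    l >= 0 (or k, l > 0 if a1 <> 0, in the last case), so that w = 0.  The
    conjugations in the map produce the norm factors |x|^2, and its signs make
    k and - l opposite in all three cases.

    Everything about octonions used here holds in any real vector space with a
    conjugation and a product that satisfy [star_algebra]; the
    Cayley-Dickson doubling of an associative such algebra is one
    ([cd_star_algebra]), and R, C, H are associative.

    The values lie in Im(K) + K^6 because a commutator is conjugated to its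
    opposite ([re_commutator]). *)

(** * Linear maps and the Euclidean norm *)

(** For maps that carry no canonical linear structure, such as [mul^~ y]. *)
Section LinearMaps.
Variables (R : pzRingType) (V W : lmodType R) (f : V -> W).
Hypothesis lin_f : linear f.

Lemma lin_add x y : f (x + y) = f x + f y.
Proof. by have := lin_f 1 x y; rewrite !scale1r. Qed.

Lemma lin_zero : f 0 = 0.
Proof. by apply: (addrI (f 0)); rewrite -lin_add !addr0. Qed.

Lemma lin_scale a x : f (a *: x) = a *: f x.
Proof. by have := lin_f a x 0; rewrite lin_zero !addr0. Qed.

Lemma lin_opp x : f (- x) = - f x.
Proof. by rewrite -scaleN1r lin_scale scaleN1r. Qed.

End LinearMaps.

Definition normsq (R : realType) n (x : 'rV[R]_n) : R := \sum_i x 0 i ^+ 2.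

Lemma normsq_ge0 (R : realType) n (x : 'rV[R]_n) : 0 <= normsq x.
Proof. by apply: sumr_ge0 => i _; rewrite sqr_ge0. Qed.

Lemma normsq_eq0 (R : realType) n (x : 'rV[R]_n) : (normsq x == 0) = (x == 0).
Proof.
apply/idP/eqP => [|->]; last first.
  by apply/eqP; apply: big1 => i _; rewrite mxE expr0n.
rewrite psumr_eq0 => [/allP x0|i _]; last exact: sqr_ge0.
apply/rowP => i; rewrite mxE; apply/eqP; rewrite -sqrf_eq0.
by apply: x0; rewrite mem_index_enum.
Qed.

Lemma normsq_gt0 (R : realType) n (x : 'rV[R]_n) : (0 < normsq x) = (x != 0).
Proof. by rewrite lt_def normsq_ge0 normsq_eq0 andbT. Qed.

Lemma normsqN (R : realType) n (x : 'rV[R]_n) : normsq (- x) = normsq x.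
Proof. by apply: eq_bigr => i _; rewrite mxE sqrrN. Qed.

Lemma normsq_row_mx (R : realType) m n (x : 'rV[R]_m) (y : 'rV[R]_n) :
  normsq (row_mx x y) = normsq x + normsq y.
Proof.
rewrite /normsq big_split_ord /=.
by congr (_ + _); apply: eq_bigr => i _; rewrite ?row_mxEl ?row_mxEr.
Qed.

(** * Unital algebras with x^* (x y) = |x|^2 y *)

(** What R, C, H and the octonions have in common.  The mirror image of
    [sa_mulKl] is [smulKr]. *)
Record star_algebra (R : realType) n (re : 'rV[R]_n -> R) (one : 'rV[R]_n)
    (conj : 'rV[R]_n -> 'rV[R]_n) (mul : 'rV[R]_n -> 'rV[R]_n -> 'rV[R]_n) :
    Prop := StarAlgebra {
  sa_mul_linl : forall y, linear (mul^~ y);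
  sa_mul_linr : forall x, linear (mul x);
  sa_conj_lin : linear conj;
  sa_mul1 : left_id one mul;
  sa_mulr1 : right_id one mul;
  sa_conj1 : conj one = one;
  sa_conjK : involutive conj;
  sa_conjM : {morph conj : x y / mul x y >-> mul y x};
  sa_trace : forall x, x + conj x = (re x *+ 2) *: one;
  sa_normsq_conj : forall x, normsq (conj x) = normsq x;
  sa_mulKl : forall x y, mul (conj x) (mul x y) = normsq x *: y }.

Section Theory.
Variables (R : realType) (n : nat) (re : 'rV[R]_n -> R) (one : 'rV[R]_n).
Variables (conj : 'rV[R]_n -> 'rV[R]_n) (mul : 'rV[R]_n -> 'rV[R]_n -> 'rV[R]_n).
Hypothesis SA : star_algebra re one conj mul.
Local Notation "x ** y" := (mul x y) (at level 40, left associativity).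

Lemma smulDl x y z : (x + y) ** z = x ** z + y ** z.
Proof. exact: (lin_add (sa_mul_linl SA z)). Qed.
Lemma smulDr x y z : z ** (x + y) = z ** x + z ** y.
Proof. exact: (lin_add (sa_mul_linr SA z)). Qed.
Lemma smulZl k x y : (k *: x) ** y = k *: (x ** y).
Proof. exact: (lin_scale (sa_mul_linl SA y)). Qed.
Lemma smulZr k x y : x ** (k *: y) = k *: (x ** y).
Proof. exact: (lin_scale (sa_mul_linr SA x)). Qed.
Lemma smulNl x y : (- x) ** y = - (x ** y).
Proof. exact: (lin_opp (sa_mul_linl SA y)). Qed.
Lemma smulNr x y : x ** (- y) = - (x ** y).
Proof. exact: (lin_opp (sa_mul_linr SA x)). Qed.
Lemma smul0l y : 0 ** y = 0.
Proof. exact: (lin_zero (sa_mul_linl SA y)). Qed.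
Lemma smul0r x : x ** 0 = 0.
Proof. exact: (lin_zero (sa_mul_linr SA x)). Qed.
Lemma sconjD x y : conj (x + y) = conj x + conj y.
Proof. exact: (lin_add (sa_conj_lin SA)). Qed.
Lemma sconjZ k x : conj (k *: x) = k *: conj x.
Proof. exact: (lin_scale (sa_conj_lin SA)). Qed.
Lemma sconjN x : conj (- x) = - conj x.
Proof. exact: (lin_opp (sa_conj_lin SA)). Qed.
Lemma sconj0 : conj 0 = 0.
Proof. exact: (lin_zero (sa_conj_lin SA)). Qed.

Lemma smulVKl x y : x ** (conj x ** y) = normsq x *: y.
Proof. by rewrite -(sa_normsq_conj SA) -(sa_mulKl SA) (sa_conjK SA). Qed.

Lemma smulKr x y : (y ** x) ** conj x = normsq x *: y.
Proof.
apply: (can_inj (sa_conjK SA)).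
by rewrite !(sa_conjM SA) (sa_conjK SA) smulVKl sconjZ.
Qed.

Lemma smulVKr x y : (y ** conj x) ** x = normsq x *: y.
Proof. by rewrite -{2}(sa_conjK SA x) smulKr (sa_normsq_conj SA). Qed.

Lemma smul_eq0 x y : x ** y = 0 -> x = 0 \/ y = 0.
Proof.
move=> xy0; have := sa_mulKl SA x y; rewrite xy0 smul0r => /esym/eqP.
by rewrite scaler_eq0 normsq_eq0 => /orP[]/eqP; [left | right].
Qed.

Lemma smul_eq0E x y : (x ** y == 0) = (x == 0) || (y == 0).
Proof.
apply/eqP/orP => [/smul_eq0[]->|[]/eqP->]; rewrite ?eqxx.
- by left.
- by right.
- exact: smul0l _.
- exact: smul0r _.
Qed.

Lemma sconj_eq0 x : (conj x == 0) = (x == 0).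
Proof. by rewrite -normsq_eq0 (sa_normsq_conj SA) normsq_eq0. Qed.

Lemma smulIl x y z : x != 0 -> x ** y = x ** z -> y = z.
Proof.
move=> x0 /eqP; rewrite -subr_eq0 -smulNr -smulDr => /eqP/smul_eq0[xe|].
  by rewrite xe eqxx in x0.
by move/eqP; rewrite subr_eq0 => /eqP.
Qed.

Lemma smulIr x y z : x != 0 -> y ** x = z ** x -> y = z.
Proof.
move=> x0 /eqP; rewrite -subr_eq0 -smulNl -smulDl => /eqP/smul_eq0[|xe].
  by move/eqP; rewrite subr_eq0 => /eqP.
by rewrite xe eqxx in x0.
Qed.

Lemma sconj_mul x : conj x ** x = normsq x *: one.
Proof. by rewrite -{2}[x](sa_mulr1 SA) (sa_mulKl SA). Qed.

Lemma smul_conj x : x ** conj x = normsq x *: one.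
Proof. by rewrite -[conj x](sa_mulr1 SA) smulVKl. Qed.

Lemma sconjE x : conj x = (re x *+ 2) *: one - x.
Proof. by rewrite -(sa_trace SA) [x + _]addrC addrK. Qed.

(** In terms of L, the operator of left multiplication, [sa_mulKl] is
    L(conj x) L(x) = |x|^2; as conj x = 2 Re x - x, it is a quadratic equation
    for L(x), and x satisfies the same equation. *)
Lemma smul_alt x y : x ** (x ** y) = (x ** x) ** y.
Proof.
have mulxE z : x ** z = (re x *+ 2) *: z - conj x ** z.
  by rewrite -[X in _ *: X](sa_mul1 SA) -smulZl -(sa_trace SA) smulDl addrK.
rewrite mulxE (sa_mulKl SA) [x ** x]mulxE sconj_mul.
by rewrite smulDl smulNl !smulZl (sa_mul1 SA).
Qed.

(** Replacing each conj x by 2 Re x - x, the terms that involve real parts are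
    symmetric in x and y and cancel in the commutator. *)
Lemma sconj_commutator x y :
  conj (x ** y - y ** x) = - (x ** y - y ** x).
Proof.
rewrite sconjD sconjN !(sa_conjM SA) !sconjE.
rewrite !(smulDl, smulDr, smulNl, smulNr, smulZl, smulZr) !(sa_mul1 SA, sa_mulr1 SA).
by apply/rowP => i; rewrite !mxE; ring.
Qed.

Lemma re_commutator x y : one != 0 -> re (x ** y - y ** x) = 0.
Proof.
move=> one0; set c := _ - _.
have := sa_trace SA c; rewrite sconj_commutator subrr => /esym/eqP.
by rewrite scaler_eq0 (negPf one0) orbF mulrn_eq0 /= => /eqP.
Qed.

(** The imaginary parts x', y' also commute, so conjugation fixes x' y', which
    is then a real number r; multiplying by y' on the right gives
    - |y'|^2 x' = r y'. *)
Lemma commute_span x y : x ** y = y ** x ->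
  (exists r, y = r *: one) \/ (exists r s, x = r *: one + s *: y).
Proof.
move=> xyC.
pose x' := x - re x *: one; pose y' := y - re y *: one.
have conjx : conj x' = - x'.
  rewrite sconjD sconjN sconjZ (sa_conj1 SA) sconjE.
  by apply/rowP => i; rewrite !mxE; ring.
have conjy : conj y' = - y'.
  rewrite sconjD sconjN sconjZ (sa_conj1 SA) sconjE.
  by apply/rowP => i; rewrite !mxE; ring.
have xyC' : x' ** y' = y' ** x'.
  rewrite !(smulDl, smulDr, smulNl, smulNr, smulZl, smulZr).
  by rewrite !(sa_mul1 SA, sa_mulr1 SA) xyC; apply/rowP => i; rewrite !mxE; ring.
have xyR : x' ** y' = re (x' ** y') *: one.
  have := sa_trace SA (x' ** y').
  rewrite (sa_conjM SA) conjx conjy smulNl smulNr opprK -xyC' -mulr2n.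
  by move/rowP => H; apply/rowP => i; have := H i; rewrite !mxE => ?; lra.
have [y0|y0] := eqVneq y' 0.
  by left; exists (re y); apply/eqP; rewrite -subr_eq0; apply/eqP.
right; have Ny0 : normsq y' != 0 by rewrite normsq_eq0.
have := smulKr y' x'; rewrite xyR smulZl (sa_mul1 SA) conjy => H.
pose s := - ((normsq y')^-1 * re (x' ** y')).
have x'E : x' = s *: y'.
  apply: (scalerI Ny0); rewrite -H scalerA scalerN /s -scaleNr.
  by congr (_ *: _); rewrite mulrN mulrA divff ?mul1r.
exists (re x - s * re y), s.
apply/eqP; rewrite -subr_eq0; apply/eqP; move/eqP: x'E.
rewrite -subr_eq0 => /eqP <-; rewrite /x' /y'.
by apply/rowP => i; rewrite !mxE; ring.
Qed.

(** By [commute_span] left multiplication by x is a combination of the identity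
    and of left multiplication by y, so the left alternative law applies. *)
Lemma commute_mulA x y : x ** y = y ** x ->
  forall z, x ** (y ** z) = (x ** y) ** z.
Proof.
case/commute_span => [[r ->]|[r [s ->]]] z.
  by rewrite !(smulZl, smulZr) (sa_mul1 SA) (sa_mulr1 SA).
by rewrite !(smulDl, smulZl) !(sa_mul1 SA) smul_alt.
Qed.

Lemma commute_conj x y : x ** y = y ** x -> conj x ** conj y = conj y ** conj x.
Proof. by rewrite -!(sa_conjM SA) => ->. Qed.

Lemma commute_mul x y : x ** y = y ** x -> x ** (x ** y) = (x ** y) ** x.
Proof. by move=> xy; rewrite {1}xy (commute_mulA xy). Qed.

End Theory.

(** * Cayley-Dickson doubling *)

Section Doubling.
Variables (R : realType) (n : nat) (re : 'rV[R]_n -> R) (one : 'rV[R]_n).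
Variables (conj : 'rV[R]_n -> 'rV[R]_n) (mul : 'rV[R]_n -> 'rV[R]_n -> 'rV[R]_n).
Hypothesis SA : star_algebra re one conj mul.
Local Notation "x ** y" := (mul x y) (at level 40, left associativity).

Lemma cd_mul_row p q r s : cd_mul conj mul (row_mx p q) (row_mx r s) =
  row_mx (p ** r - conj s ** q) (s ** p + q ** conj r).
Proof. by rewrite /cd_mul !row_mxKl !row_mxKr. Qed.

Lemma cd_conj_row p q : cd_conj conj (row_mx p q) = row_mx (conj p) (- q).
Proof. by rewrite /cd_conj row_mxKl row_mxKr. Qed.

(** Associativity of [mul] serves for the norm law: it makes the mixed terms of
    (conj x) (x y), such as (conj p) (conj s) q, occur twice with opposite
    signs. *)
Lemma cd_star_algebra : associative mul ->
  star_algebra (fun x : 'rV_(n + n) => re (lsubmx x)) (row_mx one 0)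
    (cd_conj conj) (cd_mul conj mul).
Proof.
move=> mulA; split.
- move=> y k x x'; rewrite -[x]hsubmxK -[x']hsubmxK -[y]hsubmxK.
  rewrite scale_row_mx add_row_mx !cd_mul_row scale_row_mx add_row_mx.
  rewrite !(smulDl SA, smulDr SA, smulZl SA, smulZr SA).
  by congr row_mx; apply/rowP => i; rewrite !mxE; ring.
- move=> x k y y'; rewrite -[x]hsubmxK -[y]hsubmxK -[y']hsubmxK.
  rewrite scale_row_mx add_row_mx !cd_mul_row scale_row_mx add_row_mx.
  rewrite !(sconjD SA, sconjZ SA) !(smulDl SA, smulDr SA, smulZl SA, smulZr SA).
  by congr row_mx; apply/rowP => i; rewrite !mxE; ring.
- move=> k x y; rewrite -[x]hsubmxK -[y]hsubmxK scale_row_mx add_row_mx.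
  rewrite !cd_conj_row scale_row_mx add_row_mx (sconjD SA) (sconjZ SA).
  by rewrite opprD scalerN.
- move=> x; rewrite -[x]hsubmxK cd_mul_row (sa_mul1 SA) (smul0l SA).
  by rewrite (smul0r SA) (sa_mulr1 SA) subr0 addr0.
- move=> x; rewrite -[x]hsubmxK cd_mul_row (sa_conj1 SA) (sconj0 SA).
  by rewrite !(sa_mulr1 SA) !(smul0l SA) subr0 add0r.
- by rewrite cd_conj_row (sa_conj1 SA) oppr0.
- by move=> x; rewrite -[x]hsubmxK !cd_conj_row (sa_conjK SA) opprK.
- move=> x y; rewrite -[x]hsubmxK -[y]hsubmxK !(cd_mul_row, cd_conj_row).
  rewrite !(sconjD SA, sconjN SA, sa_conjM SA, sa_conjK SA).
  rewrite !(smulNl SA, smulNr SA) opprK opprD; congr row_mx.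
  by rewrite addrC.
- move=> x; rewrite -{1 2}[x]hsubmxK cd_conj_row add_row_mx subrr (sa_trace SA).
  by rewrite scale_row_mx scaler0.
- move=> x; rewrite -[x]hsubmxK cd_conj_row !normsq_row_mx normsqN.
  by rewrite (sa_normsq_conj SA).
move=> x y; rewrite -[x]hsubmxK -[y]hsubmxK cd_conj_row !cd_mul_row.
move: (lsubmx x) (rsubmx x) (lsubmx y) (rsubmx y) => p q r s.
rewrite !(sconjD SA, sconjN SA, sa_conjM SA, sa_conjK SA) normsq_row_mx.
rewrite !(smulDl SA, smulDr SA, smulNl SA, smulNr SA) scale_row_mx.
rewrite -!mulA (sa_mulKl SA) !(mulA (conj p) (conj s)).
rewrite (smul_conj SA) (sconj_mul SA) !(mulA q) (smul_conj SA) !(smulZl SA, smulZr SA).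
rewrite (sa_mul1 SA) !(sa_mulr1 SA).
congr row_mx; apply/rowP => i; rewrite !mxE; ring.
Qed.

Lemma cd_mulA : associative mul -> commutative mul ->
  associative (cd_mul conj mul).
Proof.
move=> mulA mulC x y z; rewrite -[x]hsubmxK -[y]hsubmxK -[z]hsubmxK !cd_mul_row.
move: (lsubmx x) (rsubmx x) (lsubmx y) (rsubmx y) (lsubmx z) (rsubmx z).
move=> p q r s t u.
rewrite !(sconjD SA, sconjN SA, sa_conjM SA, sa_conjK SA).
rewrite !(smulDl SA, smulDr SA, smulNl SA, smulNr SA) -!mulA.
have mulCA a b c : a ** (b ** c) = b ** (a ** c) by rewrite mulA [a ** b]mulC -mulA.
congr row_mx.
  rewrite [p ** (conj u ** s)]mulCA [s ** p]mulC.
  rewrite [conj r ** _]mulCA [t ** _]mulCA [q ** t]mulC [q ** conj r]mulC.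
  by apply/rowP => i; rewrite !mxE; ring.
rewrite [r ** p]mulC [conj t ** p]mulC [conj t ** conj r]mulC.
rewrite [conj s ** q]mulC [u ** (q ** _)]mulCA [conj s ** u]mulC.
by apply/rowP => i; rewrite !mxE; ring.
Qed.

Lemma cd_mulC : commutative mul -> conj =1 id -> commutative (cd_mul conj mul).
Proof.
move=> mulC conj_id x y; rewrite -[x]hsubmxK -[y]hsubmxK !cd_mul_row !conj_id.
congr row_mx; last by rewrite addrC.
by rewrite [in RHS]mulC [rsubmx x ** _]mulC.
Qed.

End Doubling.

(** * From the reals to the octonions *)

Section Octonions.
Variable R : realType.

Definition oone : oct R := row_mx (row_mx (row_mx 1 0 : 'rV_2) 0 : 'rV_4) 0.

Lemma rmulE (x y : 'rV[R]_1) : rmul x y = x 0 0 *: y.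
Proof. by apply/rowP => i; rewrite !mxE big_ord1. Qed.

Lemma rmulC : commutative (@rmul R).
Proof.
by move=> x y; rewrite !rmulE; apply/rowP => i; rewrite !mxE !ord1 mulrC.
Qed.

Lemma real_star_algebra :
  star_algebra (fun x : 'rV[R]_1 => x 0 0) 1 (@rconj R) (@rmul R).
Proof.
have one00 : (1 : 'rV[R]_1) 0 0 = 1 by rewrite mxE.
split=> //.
- by move=> y k x x'; rewrite /rmul mulmxDl scalemxAl.
- by move=> x k y y'; rewrite /rmul mulmxDr scalemxAr.
- exact: mul1mx.
- exact: mulmx1.
- by move=> x y; rewrite /rconj rmulC.
- by move=> x; apply/rowP => i; rewrite ord1 !mxE mulr1.
- move=> x y; rewrite /rconj !rmulE scalerA; congr (_ *: _).
  by rewrite /normsq big_ord1 expr2.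
Qed.

Lemma complex_star_algebra :
  star_algebra (fun x : 'rV[R]_2 => (lsubmx (x : 'rV_(1 + 1))) 0 0)
    (row_mx 1 0 : 'rV_2) (@cconj R) (@cmul R).
Proof. exact: (cd_star_algebra real_star_algebra (@mulmxA R 1 1 1 1)). Qed.

Lemma cmulA : associative (@cmul R).
Proof. exact: (cd_mulA real_star_algebra (@mulmxA R 1 1 1 1) rmulC). Qed.

Lemma cmulC : commutative (@cmul R).
Proof. exact: (cd_mulC rmulC). Qed.

Lemma quaternion_star_algebra :
  star_algebra
    (fun x : 'rV[R]_4 => (lsubmx (lsubmx (x : 'rV_(2 + 2)) : 'rV_(1 + 1))) 0 0)
    (row_mx (row_mx 1 0 : 'rV_2) 0 : 'rV_4) (@qconj R) (@qmul R).
Proof. exact: (cd_star_algebra complex_star_algebra cmulA). Qed.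

Lemma qmulA : associative (@qmul R).
Proof. exact: (cd_mulA complex_star_algebra cmulA cmulC). Qed.

Lemma oct_star_algebra : star_algebra (@ore R) oone (@oconj R) (@omul R).
Proof.
have /= SA := cd_star_algebra quaternion_star_algebra qmulA.
suff -> : @ore R = (fun x : oct R => (lsubmx (lsubmx (lsubmx (x : 'rV_(4 + 4))
            : 'rV_(2 + 2)) : 'rV_(1 + 1))) 0 0) by exact: SA.
apply/boolp.funext => x; rewrite !mxE /ore.
by congr (x _ _); apply/val_inj.
Qed.

Lemma oone_neq0 : oone != 0.
Proof.
by rewrite /oone (@row_mx_eq0 R 1 4 4) (@row_mx_eq0 R 1 2 2) (@row_mx_eq0 R 1 1 1) oner_eq0.
Qed.

End Octonions.

(** * Solving the equations *)

Section Equations.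
Variables (R : realType) (n : nat) (re : 'rV[R]_n -> R) (one : 'rV[R]_n).
Variables (conj : 'rV[R]_n -> 'rV[R]_n) (mul : 'rV[R]_n -> 'rV[R]_n -> 'rV[R]_n).
Hypothesis SA : star_algebra re one conj mul.
Local Notation "x ** y" := (mul x y) (at level 40, left associativity).

(** One turn around the cycle of equations reproduces x up to the factor
    - l / k. *)
Lemma opposite_scales_eq0 (k l : R) (x : 'rV[R]_n) :
  0 < k -> 0 <= l -> k *: x = - (l *: x) -> x = 0.
Proof.
move=> k0 l0 /eqP; rewrite -subr_eq0 opprK -scalerDl scaler_eq0.
by rewrite gt_eqF ?ltr_wpDr // => /eqP.
Qed.

(** Here a2 = a3 = 0.  The equations c4, c3, c2 give in turn
    b3 ~ - b0 a0 a1, then conj b2 ~ - b0, then b1 ~ conj a1 (a0 b0), up to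
    nonnegative factors; then c1 reads (conj b0) a1 = - l (conj b0) a1 with l >= 0. *)
Lemma eq0_of_b3_neq0 a0 a1 b0 b1 b2 b3 :
  a0 ** b0 = b0 ** a0 ->
  conj b0 ** a1 = - (a0 ** conj b1) ->
  a1 ** b1 = - (a0 ** conj b2) ->
  conj b2 ** a1 = conj a0 ** b3 ->
  b3 ** conj a1 = - (b0 ** a0 *+ 3) ->
  b3 != 0 -> a0 = 0 /\ a1 = 0.
Proof.
move=> ab c1 c2 c3 c4 b3n0.
have [a1_0|a1n0] := eqVneq a1 0.
  split=> //; move: c3; rewrite a1_0 (smul0r SA) => /esym/(smul_eq0 SA)[a0_0|b3_0].
    by rewrite -[a0](sa_conjK SA) a0_0 (sconj0 SA).
  by rewrite b3_0 eqxx in b3n0.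
case/eqP: b3n0; set N := normsq a1; set m := normsq a0.
have N0 : 0 < N by rewrite normsq_gt0.
have m0 : 0 <= m by exact: normsq_ge0.
have Nb3 : N *: b3 = - 3 *: (a0 ** (b0 ** a1)).
  rewrite -(smulVKr SA) c4 (commute_mulA SA) // ab.
  by rewrite -scaler_nat (smulNl SA) (smulZl SA) scaleNr.
have Nb2 : N *: conj b2 = (- 3 * m) *: b0.
  apply: (smulIr SA a1n0); rewrite !(smulZl SA) c3 -(smulZr SA) Nb3 (smulZr SA).
  by rewrite (sa_mulKl SA) scalerA.
have Nb1 : N ^+ 2 *: b1 = (3 * m) *: (conj a1 ** (a0 ** b0)).
  rewrite expr2 -scalerA -(sa_mulKl SA) (smulZr SA) c2 scalerN -(smulZr SA N).
  by rewrite Nb2 (smulZr SA) -scaleNr mulNr opprK (smulZr SA).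
have Nb1c : N ^+ 2 *: conj b1 = (3 * m) *: (conj a0 ** (conj b0 ** a1)).
  rewrite -(sconjZ SA) Nb1 (sconjZ SA) !(sa_conjM SA) (sa_conjK SA).
  by rewrite (commute_mulA SA (commute_conj SA ab)) (commute_conj SA ab).
have b0a1 : conj b0 ** a1 = 0.
  apply: (@opposite_scales_eq0 (N ^+ 2) (3 * m * m)).
  - by rewrite exprn_gt0.
  - by rewrite !mulr_ge0.
  rewrite {1}c1 scalerN -(smulZr SA (N ^+ 2)) Nb1c (smulZr SA) (smulVKl SA).
  by rewrite scalerA.
have b0_0 : b0 = 0.
  case: (smul_eq0 SA b0a1) => [b0_0|a1_0]; last by rewrite a1_0 eqxx in a1n0.
  by rewrite -[b0](sa_conjK SA) b0_0 (sconj0 SA).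
apply/eqP; move/eqP: Nb3; rewrite b0_0 (smul0l SA) (smul0r SA) scaler0.
by rewrite scaler_eq0 gt_eqF.
Qed.

(** Here b2 = b3 = 0.  The equations c4, c3, c2 give in turn
    a3 ~ (b0 a0) conj b1, then a2 ~ - b0 (b0 a0), then a1 ~ (b0 a0) conj b1,
    up to nonnegative factors; then c1 reads
    a0 (conj b1) = - l a0 (conj b1) with l >= 0. *)
Lemma eq0_of_a3_neq0 a0 a1 a2 a3 b0 b1 :
  a0 ** b0 = b0 ** a0 ->
  conj b0 ** a1 = - (a0 ** conj b1) ->
  a1 ** b1 = - (conj b0 ** a2) ->
  a2 ** conj b1 = - (b0 ** a3) ->
  a3 ** b1 = b0 ** a0 *+ 3 ->
  a3 != 0 -> b0 = 0 /\ b1 = 0.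
Proof.
move=> ab c1 c2 c3 c4 a3n0.
have [b1_0|b1n0] := eqVneq b1 0.
  split=> //; move: c3; rewrite b1_0 (sconj0 SA) (smul0r SA) => /esym/eqP.
  rewrite oppr_eq0 => /eqP/(smul_eq0 SA)[//|a3_0].
  by rewrite a3_0 eqxx in a3n0.
case/eqP: a3n0; set N := normsq b1; set m := normsq b0.
have N0 : 0 < N by rewrite normsq_gt0.
have m0 : 0 <= m by exact: normsq_ge0.
have b1cn0 : conj b1 != 0.
  by rewrite -normsq_eq0 (sa_normsq_conj SA) normsq_eq0.
have bba : b0 ** (b0 ** a0) = (b0 ** a0) ** b0.
  exact: (commute_mul SA (esym ab)).
have Na3 : N *: a3 = 3 *: ((b0 ** a0) ** conj b1).
  by rewrite -(smulKr SA) c4 -scaler_nat (smulZl SA).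
have Na2 : N *: a2 = - 3 *: (b0 ** (b0 ** a0)).
  apply: (smulIr SA b1cn0); rewrite (smulZl SA) c3 scalerN -(smulZr SA N) Na3.
  by rewrite (smulZr SA) (commute_mulA SA) // (smulZl SA) scaleNr.
have Na1 : N ^+ 2 *: a1 = (3 * m) *: (b0 ** (a0 ** conj b1)).
  rewrite expr2 -scalerA -(smulKr SA) (smulZl SA) c2 scalerN -(smulZr SA N) Na2.
  rewrite (smulZr SA) (sa_mulKl SA) -scaleNr opprK scalerA (smulZl SA).
  by rewrite (commute_mulA SA).
have a0b1 : a0 ** conj b1 = 0.
  apply: (@opposite_scales_eq0 (N ^+ 2) (3 * m * m)).
  - by rewrite exprn_gt0.
  - by rewrite !mulr_ge0.
  rewrite -[LHS]opprK -scalerN -c1 -(smulZr SA (N ^+ 2)) Na1 (smulZr SA) (sa_mulKl SA).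
  by rewrite scalerA.
apply/eqP; move/eqP: Na3; rewrite -(commute_mulA SA) // a0b1 (smul0r SA).
by rewrite scaler0 scaler_eq0 gt_eqF.
Qed.

(** Here a3 = b3 = 0.  If a2 and b2 are nonzero, then so are a0 and b0.
    Eliminating b1 by c1 and a2 by c4 turns c2 into P (conj b2) = Q b0 with
    P > 0 and Q >= 0: the unknown b2 lies in the plane of a0 and b0 after all.
    With this, c3 compares a negative multiple of b0 a1 with a positive one
    unless Q = 0 or a1 = 0.  But Q is a multiple of |a1|^2, so Q = 0 anyway,
    and then b2 = 0. *)
Lemma a2_or_b2_eq0 a0 a1 a2 b0 b1 b2 :
  a0 ** b0 = b0 ** a0 ->
  conj b0 ** a1 = - (a0 ** conj b1) ->
  conj b0 ** a2 + a1 ** b1 + a0 ** conj b2 = 0 ->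
  a2 ** conj b1 = conj b2 ** a1 ->
  a2 ** b2 = b0 ** a0 *+ 3 ->
  a2 = 0 \/ b2 = 0.
Proof.
move=> ab c1 c2 c3 c4.
have [a2_0|a2n0] := eqVneq a2 0; [by left | right].
have [b2_0//|b2n0] := eqVneq b2 0.
set N := normsq b2; set m := normsq a0; set k := normsq b0; set l := normsq a1.
have N0 : 0 < N by rewrite normsq_gt0.
have a0n0 : a0 != 0.
  apply/eqP => a0_0; move: c4; rewrite a0_0 (smul0r SA) mul0rn.
  by case/(smul_eq0 SA) => e; [rewrite e eqxx in a2n0 | rewrite e eqxx in b2n0].
have b0n0 : b0 != 0.
  apply/eqP => b0_0; move: c4; rewrite b0_0 (smul0l SA) mul0rn.
  by case/(smul_eq0 SA) => e; [rewrite e eqxx in a2n0 | rewrite e eqxx in b2n0].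
have m0 : 0 < m by rewrite normsq_gt0.
have k0 : 0 < k by rewrite normsq_gt0.
have bba : b0 ** (b0 ** a0) = (b0 ** a0) ** b0.
  exact: (commute_mul SA (esym ab)).
have Na2 : N *: a2 = 3 *: ((b0 ** a0) ** conj b2).
  by rewrite -(smulKr SA) c4 -scaler_nat (smulZl SA).
have mb1 : m *: conj b1 = - (conj a0 ** (conj b0 ** a1)).
  by rewrite c1 (smulNr SA) (sa_mulKl SA) opprK.
have ma1b1 : m *: (a1 ** b1) = - l *: (a0 ** b0).
  have -> : m *: (a1 ** b1) = a1 ** conj (m *: conj b1).
    by rewrite (sconjZ SA) (sa_conjK SA) (smulZr SA).
  rewrite mb1 (sconjN SA) (commute_mulA SA (commute_conj SA ab)).
  rewrite (sa_conjM SA) -(sa_conjM SA b0) (sa_conjK SA) (smulNr SA) (smulVKl SA).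
  by rewrite scaleNr ab.
pose P := (3 * k + N) * m; pose Q := N * l.
have P0 : 0 < P by rewrite mulr_gt0 // addr_gt0 // mulr_gt0.
(* c2, multiplied by [m * N] to allow for the substitution of a2 and b1 *)
have Pb2 : P *: conj b2 = Q *: b0.
  apply: (smulIl SA a0n0); rewrite !(smulZr SA).
  have : (m * N) *: (conj b0 ** a2 + a1 ** b1 + a0 ** conj b2) = 0.
    by rewrite c2 scaler0.
  rewrite !scalerDr -scalerA -(smulZr SA N) Na2 -(commute_mulA SA) //.
  rewrite (smulZr SA) (sa_mulKl SA) [m * N]mulrC -[in X in _ + X + _]scalerA ma1b1.
  move/rowP => h; apply/rowP => i; have := h i; rewrite !mxE /P /Q -/k => ?; lra.
have PNa2 : (P * N) *: a2 = (3 * Q) *: (b0 ** (b0 ** a0)).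
  rewrite -scalerA Na2 scalerA [P * 3]mulrC -(scalerA 3 P) -(smulZr SA P) Pb2 (smulZr SA).
  by rewrite -bba scalerA.
(* c3, multiplied by [m * P * N] to allow for the substitution of a2, b1 and b2 *)
have Qb0a1 : (Q * m * (3 * k + N)) *: (b0 ** a1) = 0.
  have : (m * P * N) *: (a2 ** conj b1) = (m * P * N) *: (conj b2 ** a1).
    by rewrite c3.
  rewrite -mulrA [m * _]mulrC -[in LHS](scalerA (P * N) m) -(smulZr SA m) mb1 -(smulZl SA (P * N)).
  rewrite PNa2 (smulNr SA) (smulZl SA) -(commute_mulA SA) // -(commute_mulA SA) //.
  rewrite (smulVKl SA) !(smulZr SA) (smulVKl SA) (smulZr SA).
  have -> : (P * N * m) *: (conj b2 ** a1) = (N * m * Q) *: (b0 ** a1).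
    by rewrite -mulrA [P * _]mulrC -(scalerA (N * m) P) -(smulZl SA P) Pb2 (smulZl SA) scalerA.
  move/rowP => h; apply/rowP => i; have := h i; rewrite !mxE -/m -/k => ?; lra.
have Q0 : Q = 0.
  move/eqP: Qb0a1; rewrite scaler_eq0 -mulrA mulf_eq0 mulrC -/P (gt_eqF P0) orbF.
  case/orP => [/eqP//|/eqP/(smul_eq0 SA)[b0_0|a1_0]].
    by rewrite b0_0 eqxx in b0n0.
  by rewrite /Q /l a1_0 (eqP (_ : normsq 0 == 0)) ?mulr0 ?normsq_eq0.
apply/eqP; rewrite -normsq_eq0 -(sa_normsq_conj SA) normsq_eq0.
by move/eqP: Pb2; rewrite Q0 scale0r scaler_eq0 (gt_eqF P0).
Qed.

(** When a3 = b3 = 0 and one of a2, b2 vanishes, the equations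
    reduce one after the other to the vanishing of a product, and there are no
    zero divisors. *)
Lemma eq0_of_equations (a0 a1 a2 a3 b0 b1 b2 b3 : 'rV[R]_n) :
  a0 ** b0 - b0 ** a0 = 0 ->
  conj b0 ** a1 + a0 ** conj b1 = 0 ->
  conj b0 ** a2 + a1 ** b1 + a0 ** conj b2 = 0 ->
  b0 ** a3 + a2 ** conj b1 - conj b2 ** a1 + conj a0 ** b3 = 0 ->
  a3 ** b1 + a2 ** b2 - b3 ** conj a1 - b0 ** a0 *+ 3 = 0 ->
  a3 ** b2 + a2 ** b3 = 0 ->
  a3 ** b3 = 0 ->
  [/\ a0 = 0, a1 = 0, a2 = 0 & a3 = 0] \/ [/\ b0 = 0, b1 = 0, b2 = 0 & b3 = 0].
Proof.
move=> /eqP; rewrite subr_eq0 => /eqP c0.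
move=> /eqP; rewrite addr_eq0 => /eqP c1 c2 c3 c4 c5 c6.
have [a3_0|a3n0] := eqVneq a3 0; last first.
  have b3_0 : b3 = 0.
    by move/eqP: c6; rewrite (smul_eq0E SA) (negPf a3n0) => /eqP.
  have b2_0 : b2 = 0.
    move/eqP: c5; rewrite b3_0 (smul0r SA) addr0.
    by rewrite (smul_eq0E SA) (negPf a3n0) => /eqP.
  move: c2 c3 c4; rewrite b2_0 b3_0 (sconj0 SA) !(smul0l SA) !(smul0r SA).
  rewrite !addr0 !subr0 [b0 ** a3 + _]addrC [conj b0 ** a2 + _]addrC.
  move=> /eqP; rewrite addr_eq0 => /eqP c2 /eqP; rewrite addr_eq0 => /eqP c3.
  move=> /eqP; rewrite subr_eq0 => /eqP c4; right.
  by have [] := eq0_of_a3_neq0 c0 c1 c2 c3 c4 a3n0.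
have [b3_0|b3n0] := eqVneq b3 0; last first.
  have a2_0 : a2 = 0.
    move/eqP: c5; rewrite a3_0 (smul0l SA) add0r.
    by rewrite (smul_eq0E SA) (negPf b3n0) orbF => /eqP.
  move: c2 c3 c4; rewrite a2_0 a3_0 !(smul0l SA) !(smul0r SA) !add0r.
  move=> /eqP; rewrite addr_eq0 => /eqP c2.
  rewrite addrC => /eqP; rewrite subr_eq0 => /eqP/esym c3.
  move=> /eqP; rewrite -opprD oppr_eq0 addr_eq0 => /eqP c4; left.
  by have [] := eq0_of_b3_neq0 c0 c1 c2 c3 c4 b3n0.
move: c3 c4; rewrite a3_0 b3_0 !(smul0l SA) !(smul0r SA) add0r addr0 add0r subr0.
move=> /eqP; rewrite subr_eq0 => /eqP c3 /eqP; rewrite subr_eq0 => /eqP c4.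
have [a2_0|b2_0] := a2_or_b2_eq0 c0 c1 c2 c3 c4.
- move: c1 c2 c3 c4; rewrite a2_0 !(smul0l SA) !(smul0r SA) add0r => /eqP c1 /eqP c2.
  move=> /esym/eqP; rewrite (smul_eq0E SA) (sconj_eq0 SA) => c3.
  move=> /esym/eqP; rewrite -scaler_nat scaler_eq0 pnatr_eq0 /= (smul_eq0E SA) => c4.
  have [a0_0|a0n0] := eqVneq a0 0.
    move: c1 c2; rewrite a0_0 !(smul0l SA) addr0 oppr0 !(smul_eq0E SA) (sconj_eq0 SA).
    have [->|a1n0] := eqVneq a1 0; first by left.
    move: c3; rewrite (negPf a1n0) !orbF /= => /eqP b2_0 /eqP b0_0 /eqP b1_0.
    by right.
  move: c4; rewrite (negPf a0n0) orbF => /eqP b0_0.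
  move: c1; rewrite b0_0 (sconj0 SA) (smul0l SA) eq_sym oppr_eq0 (smul_eq0E SA).
  rewrite (negPf a0n0) (sconj_eq0 SA) => /eqP b1_0.
  move: c2; rewrite b1_0 (smul0r SA) add0r (smul_eq0E SA) (negPf a0n0) (sconj_eq0 SA).
  by move=> /eqP b2_0; right.
- move: c1 c2 c3 c4; rewrite b2_0 (sconj0 SA) !(smul0l SA) !(smul0r SA) addr0.
  move=> /eqP c1 /eqP c2 /eqP; rewrite (smul_eq0E SA) (sconj_eq0 SA) => c3.
  move=> /esym/eqP; rewrite -scaler_nat scaler_eq0 pnatr_eq0 /= (smul_eq0E SA) => c4.
  have [b0_0|b0n0] := eqVneq b0 0.
    move: c1 c2; rewrite b0_0 (sconj0 SA) !(smul0l SA) add0r eq_sym oppr_eq0.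
    rewrite !(smul_eq0E SA) (sconj_eq0 SA).
    have [->|b1n0] := eqVneq b1 0; first by right.
    move: c3; rewrite (negPf b1n0) !orbF => /eqP a2_0 /eqP a0_0 /eqP a1_0.
    by left.
  move: c4; rewrite (negPf b0n0) => /eqP a0_0.
  move: c1; rewrite a0_0 (smul0l SA) oppr0 (smul_eq0E SA) (sconj_eq0 SA) (negPf b0n0).
  move=> /eqP a1_0; move: c2.
  rewrite a1_0 (smul0l SA) addr0 (smul_eq0E SA) (sconj_eq0 SA) (negPf b0n0) => /eqP a2_0.
  by left.
Qed.

End Equations.

(** * The bilinear map *)

Local Notation "x ** y" := (omul x y) (at level 40, left associativity).

(* Products are compared as such, and not by their coordinates. *)
Local Opaque omul oconj.

Section Main.
Variable R : realType.
Let SA := oct_star_algebra R.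

(** The rows of [PhiM] as a function of octonions, which separates the algebra
    from the extraction of rows. *)
Definition PhiM_rows (a0 a1 a2 a3 b0 b1 b2 b3 : oct R) : seq (oct R) :=
  [:: a0 ** b0 - b0 ** a0;
      oconj b0 ** a1 + a0 ** oconj b1;
      oconj b0 ** a2 + a1 ** b1 + a0 ** oconj b2;
      b0 ** a3 + a2 ** oconj b1 - oconj b2 ** a1 + oconj a0 ** b3;
      a3 ** b1 + a2 ** b2 - b3 ** oconj a1 - (b0 ** a0) *+ 3;
      a3 ** b2 + a2 ** b3;
      a3 ** b3].

Lemma row_PhiM (a b : 'M[R]_(4, 8)) (k : 'I_7) :
  row k (PhiM a b) =
  nth 0 (PhiM_rows (row 0 a) (row 1 a) (row 2 a) (row 3 a)
                   (row 0 b) (row 1 b) (row 2 b) (row 3 b)) k.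
Proof. exact: rowK. Qed.

Local Opaque PhiM.

Lemma row_lin m n (i : 'I_m) k (x y : 'M[R]_(m, n)) :
  row i (k *: x + y) = k *: row i x + row i y.
Proof. by apply/rowP => j; rewrite !mxE. Qed.

Lemma PhiM_bilinear : bilinear_for *:%R *:%R (@PhiM R).
Proof.
(* [row_PhiM] is applied to each of the three rows separately: looking for its
   instances by unification would compare these rows by their coordinates. *)
split=> [b k a a'|a k b b']; apply/row_matrixP => i; rewrite row_lin;
  apply: etrans (row_PhiM _ _ i) _; apply: esym;
  apply: etrans (congr2 (fun u v => k *: u + v) (row_PhiM _ _ i) (row_PhiM _ _ i)) _;
  rewrite !row_lin;
  case: i => -[|[|[|[|[|[|[|//]]]]]]] ? /=;
  rewrite ?(sconjD SA) ?(sconjZ SA) ?(smulDl SA, smulDr SA, smulZl SA, smulZr SA);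
  repeat move: (omul _ _) => ?;
  by apply/rowP => j; rewrite !mxE; ring.
Qed.

Lemma PhiM_im (a b : 'M[R]_(4, 8)) : ImK_K6 (PhiM a b).
Proof. by rewrite /ImK_K6 row_PhiM /= (re_commutator SA) // oone_neq0. Qed.

Lemma matrix4_eq0 (a : 'M[R]_(4, 8)) :
  row 0 a = 0 -> row 1 a = 0 -> row 2 a = 0 -> row 3 a = 0 -> a = 0.
Proof.
move=> h0 h1 h2 h3; apply/row_matrixP => i; rewrite row0.
by case: i => -[|[|[|[|//]]]] ?;
  [rewrite -h0|rewrite -h1|rewrite -h2|rewrite -h3]; congr (row _ a); apply/val_inj.
Qed.

Lemma PhiM_nonsingular : nonsingular (@PhiM R).
Proof.
move=> a b ab0.
have c k := congr1 (row k) ab0.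
move: (c 0) (c 1) (c 2) (c 3) (c 4) (c 5) (c 6); rewrite {c} !row_PhiM !row0 /=.
move=> c0 c1 c2 c3 c4 c5 c6.
have [[]|[]] := eq0_of_equations SA c0 c1 c2 c3 c4 c5 c6.
  by left; apply: matrix4_eq0.
by right; apply: matrix4_eq0.
Qed.

(** * Coordinates on Im(K) + K^6 *)

Lemma coords55_linear : linear (@coords55 R).
Proof.
move=> k x y; apply/rowP => i.
rewrite !mxE; case: split => j; first by rewrite !mxE.
by case/mxvec_indexP: j => r c; rewrite !mxvecE !mxE.
Qed.

Lemma rowS_eq n (x y : 'rV[R]_(1 + n)) :
  x 0 0 = y 0 0 -> rsubmx x = rsubmx y -> x = y.
Proof.
move=> h0 hr; rewrite -[x]hsubmxK -[y]hsubmxK hr; congr row_mx.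
apply/rowP => j; rewrite ord1 !mxE (_ : lshift n 0 = 0) //.
exact/val_inj.
Qed.

Lemma colS_eq m n (c d : 'M[R]_(1 + m, n)) :
  row 0 c = row 0 d -> dsubmx c = dsubmx d -> c = d.
Proof.
move=> h0 hd; rewrite -[c]vsubmxK -[d]vsubmxK hd; congr col_mx.
apply/row_matrixP => i; rewrite ord1 -[LHS]/(row 0 (usubmx c)).
have E (e : 'M[R]_(1 + m, n)) : row 0 (usubmx e) = row 0 e.
  by apply/rowP => j; rewrite !mxE; congr (e _ _); apply/val_inj.
by rewrite !E.
Qed.

Lemma coords55_inj (c d : 'M[R]_(7, 8)) :
  ImK_K6 c -> ImK_K6 d -> coords55 c = coords55 d -> c = d.
Proof.
move=> c0 d0 /(@eq_row_mx R 1 7 (6 * 8))[imE /(can_inj mxvecK) tailE].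
apply: (@colS_eq 6 8) => //; apply: (@rowS_eq 7) => //.
by rewrite -[LHS]/(ore (row 0 c)) c0.
Qed.

Lemma row0_col_mx m n (u : 'rV[R]_n) (A : 'M[R]_(m, n)) :
  row (0 : 'I_(1 + m)) (col_mx u A) = u.
Proof.
have -> : (0 : 'I_(1 + m)) = @lshift 1 m 0 by exact/val_inj.
by apply/rowP => j; rewrite mxE col_mxEu.
Qed.

Lemma coords55_unique (v : 'rV[R]_55) : exists! c, ImK_K6 c /\ coords55 c = v.
Proof.
pose u : 'rV[R]_8 := @row_mx R 1 1 7 0 (@lsubmx R 1 7 48 v).
pose c : 'M[R]_(7, 8) := @col_mx R 1 6 8 u (@vec_mx R 6 8 (@rsubmx R 1 7 48 v)).
have c0 : row 0 c = u by exact: (@row0_col_mx 6 8).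
have u0 : u 0 0 = 0.
  have -> : u 0 0 = u 0 (@lshift 1 7 0) by congr (u _ _); exact/val_inj.
  by apply: etrans (@row_mxEl R 1 1 7 0 _ 0 0) _; rewrite mxE.
have cIm : ImK_K6 c by rewrite /ImK_K6 c0.
have cv : coords55 c = v.
  rewrite /coords55 c0 (@col_mxKd R 1 6) vec_mxK (@row_mxKr R 1 1 7).
  exact: (@hsubmxK R 1 7 48).
exists c; split=> // d [dIm dv].
by apply: coords55_inj; rewrite ?cv ?dv.
Qed.

Lemma PhiM_R_bilinear : bilinear_for *:%R *:%R (@PhiM_R R).
Proof.
have [linl linr] := PhiM_bilinear.
split=> [y k x x'|x k y y']; rewrite /PhiM_R (linearP (@vec_mx R 4 8)).
  by apply: etrans (congr1 _ (linl _ _ _ _)) _; exact: coords55_linear.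
by apply: etrans (congr1 _ (linr _ _ _ _)) _; exact: coords55_linear.
Qed.

Lemma PhiM_R_nonsingular : nonsingular (@PhiM_R R).
Proof.
move=> x y xy0; have xyE : PhiM (@vec_mx R 4 8 x) (@vec_mx R 4 8 y) = 0.
  apply: coords55_inj; first exact: PhiM_im.
    by rewrite /ImK_K6 row0 /ore mxE.
  by rewrite (lin_zero coords55_linear).
have [x0|y0] := PhiM_nonsingular xyE; [left|right].
  by apply: (can_inj (@vec_mxK R 4 8)); rewrite x0 linear0.
by apply: (can_inj (@vec_mxK R 4 8)); rewrite y0 linear0.
Qed.

End Main.

Theorem theorem6p1 (R : realType) :
  [/\ bilinear_for *:%R *:%R (@PhiM R) /\ nonsingular (@PhiM R),
      forall a b : 'M[R]_(4, 8), ImK_K6 (PhiM a b),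
      linear (@coords55 R) /\
        (forall v : 'rV[R]_55, exists! c, ImK_K6 c /\ coords55 c = v) &
      bilinear_for *:%R *:%R (@PhiM_R R) /\ nonsingular (@PhiM_R R)].
Proof.
split; first by split; [exact: PhiM_bilinear | exact: PhiM_nonsingular].
- exact: PhiM_im.
- by split; [exact: coords55_linear | exact: coords55_unique].
- by split; [exact: PhiM_R_bilinear | exact: PhiM_R_nonsingular].
Qed.
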